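(* Let $(X,Y,R)$ be a relation, $R\subseteq X\times Y$, and let $\mathfrak{R}=CoShvRep(X,Y,R)$. The space of global cosections of $\mathfrak{R}$ is simplicially isomorphic to $D(Y,X,R^T)$, the Dowker complex of the transpose relation.
   Context: Abstract simplicial complexes are here collections of nonempty finite sets (simplices) closed under passing to nonempty subsets; the vertices are the elements $v$ with $\{v\}$ a simplex. For a relation $R\subseteq X\times Y$, the Dowker complex $D(X,Y,R)$ consists of the nonempty finite subsets $\sigma\subseteq X$ for which there is a $y\in Y$ with $(x,y)\in R$ for all $x\in\sigma$. For such $\sigma$, $Y_\sigma=\{y\in Y:(x,y)\in R\text{ for all }x\in\sigma\}$. The transpose is $R^T=\{(y,x):(x,y)\in R\}\subseteq Y\times X$, and $R|_{A,B}=R\cap(A\times B)$ for $A\subseteq X$, $B\subseteq Y$. $\mathfrak{R}=CoShvRep(X,Y,R)$ is the cosheaf of abstract simplicial complexes on $D(X,Y,R)$, that is, a contravariant functor from its face poset to abstract simplicial complexes, defined as follows. The costalks are $\mathfrak{R}(\sigma)=D\left(Y_\sigma,\sigma,(R|_{\sigma,Y_\sigma})^T\right)$. For $\sigma\subseteq\tau$, the extension $\mathfrak{R}(\sigma\subseteq\tau):\mathfrak{R}(\tau)\to\mathfrak{R}(\sigma)$ is the simplicial map along the inclusion $Y_\tau\hookrightarrow Y_\sigma$. The space of global cosections of a cosheaf $\mathfrak{C}$ of abstract simplicial complexes on a complex $K$ is the abstract simplicial complex obtained from the disjoint union of all costalks by gluing along the extensions. Its vertices are the classes of $\bigsqcup_{\alpha\in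 K}\{\text{vertices of }\mathfrak{C}(\alpha)\}$ under the equivalence relation generated by $c\sim\mathfrak{C}(\alpha\subseteq\beta)(c)$ for $\alpha\subseteq\beta$ and $c$ a vertex of $\mathfrak{C}(\beta)$. Its simplices are the images of the simplices of the costalks. *)

(* Defs.v *)
From mathcomp Require Import all_boot.
From mathcomp Require Import boolp classical_sets functions cardinality.
From Stdlib Require Import Relation_Operators.

Set Implicit Arguments.
Unset Strict Implicit.
Unset Printing Implicit Defensive.

Local Open Scope classical_set_scope.

(* The carrier [V] may contain points that are not vertices. *)
Record asc (V : Type) := Asc {
  simplices : set (set V);
  simplices_finite : forall s, simplices s -> finite_set s;
  simplices_nonempty : forall s, simplices s -> s !=set0;
  simplices_closed : forall s t,
    simplices s -> t `<=` s -> t !=set0 -> simplices t }.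

Definition vertices V (K : asc V) : set V := [set v | simplices K [set v]].

Definition face V (K : asc V) : Type := set_type (simplices K).

(* A simplex is a set of points of the carrier, whereas simplicial maps are
   only defined on vertices; since every element of a simplex [s] is a vertex,
   [vset K s] is [s] itself, seen inside the type of vertices. *)
Definition vset V (K : asc V) (s : set V) : set (vertices K) := \val @^-1` s.
Arguments vset {V} K s _.

Record smap V W (K : asc V) (L : asc W) := Smap {
  smap_fun :> vertices K -> vertices L;
  smap_simplex : forall s,
    simplices K s -> simplices L [set \val (smap_fun v) | v in vset K s] }.

Definition simplicially_isomorphic V W (K : asc V) (L : asc W) : Prop :=
  exists (f : smap K L) (g : smap L K), cancel f g /\ cancel g f.

Lemma incl_vertices V (K L : asc V) :
  simplices K `<=` simplices L -> vertices K `<=` vertices L.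
Proof. by move=> KL v; exact: KL. Qed.

Definition incl_fun V (K L : asc V) (KL : simplices K `<=` simplices L)
    (v : vertices K) : vertices L :=
  exist _ (\val v) (mem_set (incl_vertices KL (set_mem (valP v)))).

Lemma incl_simplex V (K L : asc V) (KL : simplices K `<=` simplices L) s :
  simplices K s -> simplices L [set \val (incl_fun KL v) | v in vset K s].
Proof.
move=> Ks; apply: (simplices_closed (KL _ Ks)).
  by move=> _ [v sv <-].
have [v sv] := simplices_nonempty Ks.
have Kv : vertices K v.
  by apply: (simplices_closed Ks); [move=> _ -> | exists v].
by exists v, (exist _ v (mem_set Kv)).
Qed.

Definition incl_smap V (K L : asc V) (KL : simplices K `<=` simplices L) :
  smap K L := Smap (incl_simplex KL).

Record cosheaf V (K : asc V) := Cosheaf {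
  costalk_carrier : face K -> Type;
  costalk : forall a, asc (costalk_carrier a);
  extension : forall a b : face K,
    \val a `<=` \val b -> smap (costalk b) (costalk a);
  extension_id : forall (a : face K) (aa : \val a `<=` \val a),
    extension aa =1 id;
  extension_comp : forall (a b c : face K) (ab : \val a `<=` \val b)
    (bc : \val b `<=` \val c) (ac : \val a `<=` \val c),
    extension ac =1 extension ab \o extension bc }.

Section Cosections.
Variables (V : Type) (K : asc V) (C : cosheaf K).

Definition costalk_vertex : Type := {a : face K & vertices (costalk C a)}.

Definition in_costalk (a : face K) (c : vertices (costalk C a)) :
  costalk_vertex := existT _ a c.

Inductive glue : costalk_vertex -> costalk_vertex -> Prop :=
  Glue (a b : face K) (ab : \val a `<=` \val b) (c : vertices (costalk C b)) :
    glue (in_costalk c) (in_costalk (extension C ab c)).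

Definition glue_class (c : costalk_vertex) : set costalk_vertex :=
  [set c' | clos_refl_sym_trans _ glue c c'].

Definition cosection_simplices : set (set (set costalk_vertex)) :=
  [set t | exists (a : face K) s, simplices (costalk C a) s /\
    t = [set glue_class (in_costalk c) | c in vset (costalk C a) s]].

Lemma cosection_finite t : cosection_simplices t -> finite_set t.
Proof.
move=> [a [s [Cs ->]]]; apply: finite_image; apply: finite_preimage.
  by move=> x y _ _; exact: val_inj.
exact: simplices_finite Cs.
Qed.

Lemma cosection_nonempty t : cosection_simplices t -> t !=set0.
Proof.
move=> [a [s [Cs ->]]]; have [v sv] := simplices_nonempty Cs.
have Cv : vertices (costalk C a) v.
  by apply: (simplices_closed Cs); [move=> _ -> | exists v].
by exists (glue_class (in_costalk (exist _ v (mem_set Cv)))), (exist _ v (mem_set Cv)).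
Qed.

Lemma cosection_closed t u :
  cosection_simplices t -> u `<=` t -> u !=set0 -> cosection_simplices u.
Proof.
move=> [a [s [Cs ->]]] us [x ux].
pose s' := [set \val c | c in
  [set c | vset (costalk C a) s c /\ u (glue_class (in_costalk c))]].
exists a, s'; split.
  apply: (simplices_closed Cs); first by move=> _ [c [sc _] <-].
  have [c sc cx] := us _ ux.
  by exists (\val c), c => //; split=> //; rewrite cx.
apply/seteqP; split=> [y uy|_ [c [c' [_ uc'] /val_inj <-]] <-//].
have [c sc cy] := us _ uy.
by exists c => //; exists c => //; split=> //; rewrite cy.
Qed.

Definition cosections : asc (set costalk_vertex) :=
  Asc cosection_finite cosection_nonempty cosection_closed.

Lemma vertices_cosections : vertices cosections = range glue_class.
Proof.
apply/seteqP; split=> [x [a [s [Cs xs]]]|_ [[a c] _ <-]].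
  have : [set x] x by [].
  by rewrite xs => -[c _ <-]; exists (in_costalk c).
exists a, [set \val c]; split; first exact: set_mem (valP c).
apply/seteqP; split=> [_ ->|_ [c' /= /val_inj -> <-]//].
by exists c.
Qed.

End Cosections.

Section Dowker.
Variables (T U : Type).
Implicit Types (X : set T) (Y : set U) (R : set (T * U)).

(* [Y_sigma] *)
Definition common_related Y R (s : set T) : set U :=
  [set y | Y y /\ forall x, s x -> R (x, y)].

Definition dowker_simplices X Y R : set (set T) :=
  [set s | [/\ finite_set s, s !=set0, s `<=` X &
    exists2 y, Y y & forall x, s x -> R (x, y)]].

Lemma dowker_finite X Y R s : dowker_simplices X Y R s -> finite_set s.
Proof. by case. Qed.

Lemma dowker_nonempty X Y R s : dowker_simplices X Y R s -> s !=set0.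
Proof. by case. Qed.

Lemma dowker_closed X Y R s t : dowker_simplices X Y R s ->
  t `<=` s -> t !=set0 -> dowker_simplices X Y R t.
Proof.
move=> [fs _ sX [y Yy sy]] ts t0; split=> //.
- exact: sub_finite_set fs.
- exact: subset_trans sX.
- by exists y => // x /ts; exact: sy.
Qed.

Definition dowker X Y R : asc T :=
  Asc (@dowker_finite X Y R) (@dowker_nonempty X Y R) (@dowker_closed X Y R).

Definition rel_restrict R (A : set T) (B : set U) : set (T * U) :=
  R `&` (A `*` B).

End Dowker.

Section CoShvRep.
Variables (T U : Type) (X : set T) (Y : set U) (R : set (T * U)).

Definition rep_costalk (s : face (dowker X Y R)) : asc U :=
  let Ys := common_related Y R (\val s) in
  dowker Ys (\val s) (rel_restrict R (\val s) Ys)^-1%relation.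

Lemma rep_costalk_sub (s t : face (dowker X Y R)) : \val s `<=` \val t ->
  simplices (rep_costalk t) `<=` simplices (rep_costalk s).
Proof.
move=> st u [fu u0 uY _].
have uYs : u `<=` common_related Y R (\val s).
  by move=> y /uY[Yy ty]; split=> // x /st; exact: ty.
have [x sx] := simplices_nonempty (set_mem (valP s)).
split=> //; exists x => // y uy; split=> /=; last by split=> //; exact: uYs.
by apply: (proj2 (uYs _ uy)).
Qed.

Definition rep_extension (s t : face (dowker X Y R)) (st : \val s `<=` \val t) :
  smap (rep_costalk t) (rep_costalk s) := incl_smap (rep_costalk_sub st).

Lemma rep_extension_id (s : face (dowker X Y R)) (ss : \val s `<=` \val s) :
  rep_extension ss =1 id.
Proof. by move=> v; exact: val_inj. Qed.

Lemma rep_extension_comp (s t u : face (dowker X Y R))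
    (st : \val s `<=` \val t) (tu : \val t `<=` \val u)
    (su : \val s `<=` \val u) :
  rep_extension su =1 rep_extension st \o rep_extension tu.
Proof. by move=> v; exact: val_inj. Qed.

Definition CoShvRep : cosheaf (dowker X Y R) :=
  Cosheaf rep_extension_id rep_extension_comp.

End CoShvRep.

(* Main.v *)
Require Import Defs.
From mathcomp Require Import all_boot.
From mathcomp Require Import boolp classical_sets functions cardinality.
From Stdlib Require Import Relation_Operators.

(** The point [y] carried by a costalk vertex is unchanged by the extensions.
    Conversely, if [y] lies in [Y_sigma] and in [Y_tau], then it witnesses that
    [sigma `|` tau] is a simplex, and the copy of [y] in the costalk there is
    glued to both of its copies at [sigma] and at [tau]. Hence the gluing classes
    are the fibers of [y], and they correspond to the vertices of [D(Y,X,R^T)].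
    A simplex of [D(Y,X,R^T)] with witness [x] is a simplex of the costalk at
    [[set x]]. *)

Set Implicit Arguments.
Unset Strict Implicit.
Unset Printing Implicit Defensive.

Local Open Scope classical_set_scope.

Lemma simplex_vertex V (K : asc V) s v :
  simplices K s -> s v -> vertices K v.
Proof.
by move=> Ks sv; apply: (simplices_closed Ks); [move=> _ -> | exists v].
Qed.

(** For a vertex [v], the simplex [[set v]] of [K] is the image of a nonempty simplex of [L], so [g]
    is onto the vertices. Its inverse, obtained by choice, takes the image of [s] back to [s] and is
    therefore simplicial. *)
Lemma isomorphic_of_inj_smap V W (K : asc V) (L : asc W) (g : smap L K) :
  injective g ->
  (forall t, simplices K t -> exists2 s, simplices L s &
    t = [set \val (g w) | w in vset L s]) ->
  simplicially_isomorphic K L.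
Proof.
move=> g_inj g_simplex.
have g_surj (v : vertices K) : exists w, g w = v.
  have [s Ls vs] := g_simplex _ (set_mem (valP v)).
  have [w sw] := simplices_nonempty Ls.
  exists (exist _ w (mem_set (simplex_vertex Ls sw))); apply: val_inj => /=.
  suff: [set \val v] (\val (g (exist _ w (mem_set (simplex_vertex Ls sw))))) by [].
  by rewrite vs; exists (exist _ w (mem_set (simplex_vertex Ls sw))).
pose f v := projT1 (cid (g_surj v)).
have fK : cancel f g by move=> v; exact: projT2 (cid (g_surj v)).
have gK : cancel g f by move=> w; apply: g_inj; rewrite fK.
have f_simplex t : simplices K t -> simplices L [set \val (f v) | v in vset K t].
  move=> /g_simplex[s Ls ->].
  suff -> : [set \val (f v) | v in vset K [set \val (g w) | w in vset L s]] = s by [].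
  apply/seteqP; split=> [_ [v [w sw /val_inj <-] <-]|w sw]; first by rewrite gK.
  pose w' : vertices L := exist _ w (mem_set (simplex_vertex Ls sw)).
  by exists (g w'); [exists w' | rewrite gK].
by exists (Smap f_simplex), g.
Qed.

Section GlobalCosections.
Variables (T U : Type) (X : set T) (Y : set U) (R : set (T * U)).

(** Any point of the nonempty [a] is related to all of [Y_a], so it witnesses every nonempty finite
    subset: the costalk is the full simplex on [Y_a]. *)
Lemma simplices_rep_costalk (a : face (dowker X Y R)) s :
  simplices (rep_costalk a) s <->
  [/\ finite_set s, s !=set0 & s `<=` common_related Y R (\val a)].
Proof.
split=> [[]//|[fs s0 sY]].
have [x ax] := simplices_nonempty (set_mem (valP a)).
split=> //; exists x => // y /sY Yy.
by split=> //; exact: (proj2 Yy).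
Qed.

Lemma vertices_rep_costalk (a : face (dowker X Y R)) y :
  vertices (rep_costalk a) y <-> common_related Y R (\val a) y.
Proof.
split=> [/simplices_rep_costalk[_ _]|ay]; first exact.
apply/simplices_rep_costalk; split; [exact: finite_set1|by exists y|].
by move=> _ ->.
Qed.

Definition label (c : costalk_vertex (CoShvRep X Y R)) : U :=
  \val (projT2 c).

Lemma related_label (c : costalk_vertex (CoShvRep X Y R)) :
  common_related Y R (\val (projT1 c)) (label c).
Proof. by apply/vertices_rep_costalk; exact: set_mem (valP (projT2 c)). Qed.

Definition rep_vertex (a : face (dowker X Y R)) y
    (ay : common_related Y R (\val a) y) : costalk_vertex (CoShvRep X Y R) :=
  @in_costalk _ _ (CoShvRep X Y R) a
    (exist _ y (mem_set (proj2 (vertices_rep_costalk a y) ay))).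

(** A costalk vertex is determined by its underlying point, and extensions keep that point. Stating
    the match through [label c = y] avoids rewriting inside the dependent pair [c]. *)
Lemma glue_rep_vertex (c : costalk_vertex (CoShvRep X Y R))
    (b : face (dowker X Y R)) y (by_ : common_related Y R (\val b) y) :
  \val (projT1 c) `<=` \val b -> label c = y ->
  Defs.glue (C := CoShvRep X Y R) (rep_vertex by_) c.
Proof.
case: c => a v /= ab vy.
have -> : existT _ a v = in_costalk (extension (CoShvRep X Y R) ab
    (exist _ y (mem_set (proj2 (vertices_rep_costalk b y) by_)))).
  by congr existT; apply: val_inj; exact: vy.
exact: Glue.
Qed.

Lemma glue_class_label (c : costalk_vertex (CoShvRep X Y R)) :
  glue_class c = label @^-1` [set label c].
Proof.
apply/seteqP; split=> [c'|c' /= cc'].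
  (* Having equal labels is an equivalence relation that contains the generating gluings. *)
  rewrite /glue_class /=; elim=> [_ _ []//|//|x y _ -> //|x y z _ -> _ -> //].
have [Yc Rc] := related_label c; have [_ Rc'] := related_label c'.
have [fc c0 cX _] := set_mem (valP (projT1 c)).
have [fc' _ c'X _] := set_mem (valP (projT1 c')).
have Rcc' x : (\val (projT1 c) `|` \val (projT1 c')) x -> R (x, label c).
  by case=> [/Rc//|/Rc']; rewrite cc'.
have Kcc' : simplices (dowker X Y R) (\val (projT1 c) `|` \val (projT1 c')).
  split.
  - by rewrite finite_setU.
  - by have [x cx] := c0; exists x; left.
  - by rewrite subUset.
  - by exists (label c).
pose b : face (dowker X Y R) :=
  exist _ (\val (projT1 c) `|` \val (projT1 c')) (mem_set Kcc').
have by_ : common_related Y R (\val b) (label c) by [].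
apply: (rst_trans _ _ _ (rep_vertex by_)).
  by apply/rst_sym/rst_step/glue_rep_vertex => // x cx; left.
by apply/rst_step/glue_rep_vertex => // x cx; right.
Qed.

Hypothesis RXY : R `<=` X `*` Y.

Lemma simplices_dowker_point x y : R (x, y) ->
  simplices (dowker X Y R) [set x].
Proof.
move=> xy; have [Xx Yy] := RXY xy.
by split; [exact: finite_set1|exists x|move=> _ ->|exists y => // _ ->].
Qed.

Lemma dowker_converseP s : simplices (dowker Y X R^-1%relation) s <->
  exists a, simplices (rep_costalk (X := X) (Y := Y) (R := R) a) s.
Proof.
split=> [[fs s0 sY [x Xx sx]]|[a /simplices_rep_costalk[fs s0 sa]]].
  have [y sy] := s0.
  exists (exist _ [set x] (mem_set (simplices_dowker_point (sx _ sy)))).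
  apply/simplices_rep_costalk; split=> // z sz; split; first exact: sY.
  by move=> _ ->; exact: sx.
(* Any point [x] of [a] is a witness for [s], because [s] lies in [Y_a]. *)
have [_ [x ax] aX _] := set_mem (valP a).
split=> // [y /sa[]//|]; exists x; first exact: aX.
by move=> y /sa[_]; exact.
Qed.

Lemma fiber_simplex (a : face (dowker X Y R)) s :
  simplices (rep_costalk a) s ->
  [set label @^-1` [set y] | y in s] =
  [set glue_class (in_costalk (C := CoShvRep X Y R) c) |
    c in vset (rep_costalk a) s].
Proof.
move=> as_; apply/seteqP; split=> [_ [y sy <-]|_ [c sc <-]].
  exists (exist _ y (mem_set (simplex_vertex as_ sy))) => //.
  by rewrite glue_class_label.
by exists (\val c) => //; rewrite glue_class_label.
Qed.

Lemma fiber_cosections s : simplices (dowker Y X R^-1%relation) s ->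
  simplices (cosections (CoShvRep X Y R)) [set label @^-1` [set y] | y in s].
Proof.
by move=> /dowker_converseP[a as_]; exists a, s; split; last exact: fiber_simplex.
Qed.

Lemma fiber_vertex y : vertices (dowker Y X R^-1%relation) y ->
  vertices (cosections (CoShvRep X Y R)) (label @^-1` [set y]).
Proof. by move=> /fiber_cosections; rewrite image_set1. Qed.

(** As gluing classes are fibers of [label], the class over [y] is given without choosing a costalk
    that contains [y]. *)
Definition fiber (y : vertices (dowker Y X R^-1%relation)) :
    vertices (cosections (CoShvRep X Y R)) :=
  exist _ (label @^-1` [set \val y]) (mem_set (fiber_vertex (set_mem (valP y)))).

Lemma image_fiber s : simplices (dowker Y X R^-1%relation) s ->
  [set \val (fiber y) | y in vset (dowker Y X R^-1%relation) s] =
  [set label @^-1` [set y] | y in s].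
Proof.
move=> Ks; apply/seteqP; split=> [_ [y sy <-]|_ [y sy <-]]; first by exists (\val y).
by exists (exist _ y (mem_set (simplex_vertex Ks sy))).
Qed.

Lemma fiber_smap_simplex s : simplices (dowker Y X R^-1%relation) s ->
  simplices (cosections (CoShvRep X Y R))
    [set \val (fiber y) | y in vset (dowker Y X R^-1%relation) s].
Proof. by move=> Ks; rewrite image_fiber//; exact: fiber_cosections. Qed.

Lemma fiber_inj : injective fiber.
Proof.
move=> y z yz; apply: val_inj.
have /dowker_converseP[a /vertices_rep_costalk ay] := set_mem (valP y).
(* The fiber over [y] is nonempty: it contains a copy of [y] in some costalk. If it is also the
   fiber over [z], this copy has label [z]. *)
have : (\val (fiber y)) (rep_vertex ay) by [].
by rewrite yz.
Qed.

End GlobalCosections.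

Theorem theorem6 (T U : Type) (X : set T) (Y : set U) (R : set (T * U))
  (RXY : R `<=` X `*` Y) :
  simplicially_isomorphic (cosections (CoShvRep X Y R))
    (dowker Y X R^-1%relation).
Proof.
(* The explicit map runs from the Dowker complex to the cosections. A simplex of cosections is the
   image under [fiber] of the costalk simplex [s] that it comes from. *)
apply: (@isomorphic_of_inj_smap _ _ _ _ (Smap (fiber_smap_simplex RXY))).
  exact: fiber_inj.
move=> _ [a [s [as_ ->]]].
have Ks : simplices (dowker Y X R^-1%relation) s.
  by apply/(dowker_converseP RXY); exists a.
by exists s => //=; rewrite image_fiber// (fiber_simplex as_).
Qed.
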